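(* Let $n\ge 1$ be an integer and $\alpha\ge 0$. For all real $a<b$ and every $r>0$, $$g_{\alpha}(a-r,b+r)-g_{\alpha}(a,b)\geq \frac{r}{2^{1/n}} .$$ If $\mu_{\alpha}(a,b)<1/2$, then $$g_{\alpha}(a-r,b+r)-g_{\alpha}(a,b)\geq r$$ for all $r>0$ which are small enough (i.e. there is $r_0>0$, depending on $a,b,\alpha,n$, such that it holds for all $0<r\le r_0$).
   Context: For an integer $n\ge1$ and $\alpha\ge0$, $\mu_\alpha$ is the probability measure on $\mathbb{R}$ with density $$f_{\alpha,n}(x)=\frac{c}{(1+\alpha^2+x^2)^{(n+1)/2}},$$ where $c=c(\alpha,n)>0$ is the normalizing constant making this a probability density; $\mu_\alpha(a,b)$ denotes the measure of the interval $(a,b)$. For real $a<b$, $g_\alpha(a,b)=g_{\alpha,n}(a,b)$ is the unique real number with $\int_{-\infty}^{g_\alpha(a,b)}f_{\alpha,n}(t)\,dt=\int_a^b f_{\alpha,n}(t)\,dt$. *)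

(* Defs.v *)
From HB Require Import structures.
From mathcomp Require Import all_boot all_order all_algebra.
From mathcomp Require Import all_classical all_reals all_analysis.
From mathcomp Require Import measurable_realfun ring lra.

Set Implicit Arguments.
Unset Strict Implicit.
Unset Printing Implicit Defensive.

Import Order.TTheory GRing.Theory Num.Theory.
Import numFieldNormedType.Exports.

Local Open Scope classical_set_scope.
Local Open Scope ring_scope.

Definition alpha_fun {R : realType} (n : nat) (alpha x : R) : R :=
  (1 + alpha ^+ 2 + x ^+ 2) `^ (n.+1%:R / 2).

(* The normalizing constant, characterized by [mu_alpha_setT] below. *)
Definition alpha_cst {R : realType} (n : nat) (alpha : R) : R :=
  (fine (\int[lebesgue_measure]_x ((alpha_fun n alpha x)^-1)%:E)%E)^-1.

Definition alpha_pdf {R : realType} (n : nat) (alpha x : R) : R :=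
  alpha_cst n alpha / alpha_fun n alpha x.

Definition mu_alpha {R : realType} (n : nat) (alpha : R) : set R -> \bar R :=
  fun A => (\int[lebesgue_measure]_(x in A) (alpha_pdf n alpha x)%:E)%E.

Definition is_g_alpha {R : realType} (n : nat) (alpha a b t : R) : Prop :=
  (\int[lebesgue_measure]_(x in `]-oo, t]) (alpha_pdf n alpha x)%:E =
   \int[lebesgue_measure]_(x in `]a, b[) (alpha_pdf n alpha x)%:E)%E.

(* The default value 0 is never used when [0 < n] and [a < b]: see
   [g_alphaP] and [g_alpha_unique]. *)
Definition g_alpha {R : realType} (n : nat) (alpha a b : R) : R :=
  xget 0 [set t | is_g_alpha n alpha a b t].

Section alpha_measure.
Context {R : realType}.
Variables (n : nat) (alpha : R).
Local Notation leb := (@lebesgue_measure R).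
Local Notation h := (alpha_fun n alpha).
Local Notation f := (alpha_pdf n alpha).
Local Notation mu := (mu_alpha n alpha).

Let base_ge1 x : 1 <= 1 + alpha ^+ 2 + x ^+ 2.
Proof. by have := sqr_ge0 alpha; have := sqr_ge0 x; lra. Qed.

Lemma alpha_fun_gt0 x : 0 < h x.
Proof. by apply: powR_gt0; apply: lt_le_trans (base_ge1 x). Qed.

Lemma alpha_fun_ge_oneDsqr x : (0 < n)%N -> oneDsqr x <= h x.
Proof.
move=> n0; have b1 := base_ge1 x.
apply: (@le_trans _ _ (1 + alpha ^+ 2 + x ^+ 2)).
  by rewrite /oneDsqr; have := sqr_ge0 alpha; lra.
rewrite -[leLHS]powRr1; last exact: le_trans b1.
by apply: ler_powR => //; rewrite ler_pdivlMr// mul1r ler_nat.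
Qed.

Lemma alpha_fun_ge1 x : 1 <= h x.
Proof. by rewrite -(powRr0 (1 + alpha ^+ 2 + x ^+ 2)); apply: ler_powR. Qed.

Lemma measurable_alpha_funV (D : set R) : measurable_fun D (fun x => (h x)^-1).
Proof.
rewrite (_ : (fun x => _) =
    (@powR R ^~ (- (n.+1%:R / 2))) \o (fun x => 1 + alpha ^+ 2 + x ^+ 2)).
  apply: measurable_funTS; apply: (measurableT_comp (measurable_powR _)).
  by apply: measurable_funD => //; apply: measurable_funX.
by apply/funext => x /=; rewrite powRN.
Qed.

Lemma measurable_alpha_pdf (D : set R) : measurable_fun D f.
Proof. by apply: measurable_funM => //; exact: measurable_alpha_funV. Qed.

Lemma integrable_alpha_funV : (0 < n)%N ->
  leb.-integrable setT (fun x => ((h x)^-1)%:E).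
Proof.
move=> n0; apply/integrableP; split.
  by apply/measurable_EFinP; exact: measurable_alpha_funV.
have m1 : measurable_fun setT (fun x : R => (oneDsqr x)^-1).
  by apply: continuous_measurable_fun; exact: continuous_oneDsqrV.
apply: (@le_lt_trans _ _ (\int[leb]_x ((oneDsqr x)^-1)%:E)%E).
  apply: ge0_le_integral => //=.
  - by apply/measurable_EFinP/measurableT_comp => //; exact: measurable_alpha_funV.
  - by apply/measurable_EFinP.
  - move=> x _; rewrite lee_fin gtr0_norm ?invr_gt0 ?alpha_fun_gt0//.
    by rewrite lef_pV2 ?posrE ?alpha_fun_gt0//; exact: alpha_fun_ge_oneDsqr.
rewrite (@ge0_symfun_integralT R (fun x => (oneDsqr x)^-1)).
- by rewrite -set_itvcy integral0y_oneDsqr -EFinM ltry.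
- by move=> x; rewrite invr_ge0.
- exact: continuous_oneDsqrV.
- by move=> x; rewrite /= /oneDsqr sqrrN.
Qed.

Lemma integral_alpha_funV_fin_num : (0 < n)%N ->
  (\int[leb]_x ((h x)^-1)%:E)%E \is a fin_num.
Proof. by move=> n0; apply: integrable_fin_num => //; exact: integrable_alpha_funV. Qed.

Lemma integral_alpha_funV_gt0 : (0 < \int[leb]_x ((h x)^-1)%:E)%E.
Proof.
pose m := (2 + alpha ^+ 2) `^ (n.+1%:R / 2).
have m0 : 0 < m by apply: powR_gt0; have := sqr_ge0 alpha; lra.
apply: (@lt_le_trans _ _ (\int[leb]_(x in `[0%R, 1%R]) cst (m^-1)%:E x)%E).
  rewrite integral_cst//= lebesgue_measure_itv/= lte_fin ltr01 sube0 mule1.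
  by rewrite lte_fin invr_gt0.
apply: (@le_trans _ _ (\int[leb]_(x in `[0%R, 1%R]) ((h x)^-1)%:E)%E).
  apply: ge0_le_integral => //=.
  - by move=> x _; rewrite lee_fin invr_ge0 ltW.
  - by apply/measurable_EFinP; exact: measurable_alpha_funV.
  - move=> x; rewrite in_itv/= => /andP[x0 x1].
    rewrite lee_fin lef_pV2 ?posrE ?alpha_fun_gt0//.
    have x21 : x ^+ 2 <= 1 by rewrite expr_le1.
    apply: ge0_ler_powR => //; rewrite ?nnegrE.
    + exact: le_trans (base_ge1 x).
    + by have := sqr_ge0 alpha; lra.
    + lra.
apply: ge0_subset_integral => //=.
- by apply/measurable_EFinP; exact: measurable_alpha_funV.
- by move=> x _; rewrite lee_fin invr_ge0 ltW ?alpha_fun_gt0.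
Qed.

Lemma alpha_cst_gt0 : (0 < n)%N -> 0 < alpha_cst n alpha.
Proof.
move=> n0; rewrite invr_gt0 fine_gt0// integral_alpha_funV_gt0/=.
by rewrite ltey_eq integral_alpha_funV_fin_num.
Qed.

Lemma alpha_cst_ge0 : 0 <= alpha_cst n alpha.
Proof. by rewrite invr_ge0 fine_ge0// ltW// integral_alpha_funV_gt0. Qed.

Lemma alpha_pdf_ge0 x : 0 <= f x.
Proof. by rewrite divr_ge0 ?alpha_cst_ge0// ltW// alpha_fun_gt0. Qed.

Lemma alpha_pdf_gt0 x : (0 < n)%N -> 0 < f x.
Proof. by move=> n0; rewrite divr_gt0 ?alpha_cst_gt0// alpha_fun_gt0. Qed.

Let mu0 : mu set0 = 0%E.
Proof. by rewrite /mu_alpha integral_set0. Qed.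

Let mu_ge0 A : (0 <= mu A)%E.
Proof. by apply: integral_ge0 => x _; rewrite lee_fin alpha_pdf_ge0. Qed.

Let mu_sigma_additive : semi_sigma_additive mu.
Proof.
move=> /= A mA tA mUA; rewrite /mu_alpha ge0_integral_bigcup//=.
- apply: is_cvg_ereal_nneg_natsum_cond => k _ _.
  by apply: integral_ge0 => x _; rewrite lee_fin alpha_pdf_ge0.
- by apply/measurable_EFinP; exact: measurable_alpha_pdf.
- by move=> x _; rewrite lee_fin alpha_pdf_ge0.
Qed.

HB.instance Definition _ := isMeasure.Build _ _ _
  mu mu0 mu_ge0 mu_sigma_additive.

Lemma mu_alpha_setT : (0 < n)%N -> mu setT = 1%E.
Proof.
move=> n0; rewrite /mu_alpha /alpha_pdf.
under eq_integral do rewrite EFinM.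
rewrite ge0_integralZl//=.
- rewrite -(fineK (integral_alpha_funV_fin_num n0)) -EFinM /alpha_cst mulVf//.
  by rewrite -invr_eq0 gt_eqF// alpha_cst_gt0.
- by apply/measurable_EFinP; exact: measurable_alpha_funV.
- by move=> x _; rewrite lee_fin invr_ge0 ltW ?alpha_fun_gt0.
- exact: alpha_cst_ge0.
Qed.

Lemma mu_alpha_fin_num (A : set R) : (0 < n)%N -> measurable A ->
  mu A \is a fin_num.
Proof.
move=> n0 mA; rewrite ge0_fin_numE//.
apply: (@le_lt_trans _ _ (mu setT)); last by rewrite mu_alpha_setT// ltry.
by apply: le_measure; rewrite ?inE.
Qed.

Lemma mu_alpha_itv_gt0 a b : (0 < n)%N -> a < b -> (0 < mu `]a, b[)%E.
Proof.
move=> n0 ab.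
pose M := Num.max (a ^+ 2) (b ^+ 2).
have M0 : 0 <= M by rewrite le_max sqr_ge0.
pose m := (1 + alpha ^+ 2 + M) `^ (n.+1%:R / 2).
have m0 : 0 < m by apply: powR_gt0; have := sqr_ge0 alpha; lra.
have c0 := alpha_cst_gt0 n0.
apply: (@lt_le_trans _ _ (\int[leb]_(x in `]a, b[) cst (alpha_cst n alpha / m)%:E x)%E).
  rewrite integral_cst//= lebesgue_measure_itv/= lte_fin ab -EFinB -EFinM.
  by rewrite lte_fin mulr_gt0 ?subr_gt0// divr_gt0.
apply: ge0_le_integral => //=.
- by move=> x _; rewrite lee_fin divr_ge0// ltW.
- by apply/measurable_EFinP; exact: measurable_alpha_pdf.
- move=> x; rewrite in_itv/= => /andP[ax xb].
  rewrite lee_fin ler_pM2l// lef_pV2 ?posrE ?alpha_fun_gt0//.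
  have xM : x ^+ 2 <= M.
    rewrite le_max; have [x0|x0] := leP 0 x; apply/orP; [right|left]; nra.
  apply: ge0_ler_powR => //; rewrite ?nnegrE.
  + exact: le_trans (base_ge1 x).
  + by have := sqr_ge0 alpha; lra.
  + lra.
Qed.

Lemma mu_alpha_itvNyc s t : s <= t ->
  mu `]-oo, t] = (mu `]-oo, s] + mu `]s, t])%E.
Proof.
move=> st; rewrite -measureU//=; last first.
  rewrite -subset0 => x [] /=; rewrite !in_itv/= => xs /andP[sx _].
  by move: (le_lt_trans xs sx); rewrite ltxx.
by rewrite -itv_bndbnd_setU.
Qed.

Lemma mu_alpha_itvNyc_lt s t : (0 < n)%N -> s < t ->
  (mu `]-oo, s] < mu `]-oo, t])%E.
Proof.
move=> n0 st; rewrite (mu_alpha_itvNyc (ltW st)) lteDl ?mu_alpha_fin_num//.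
apply: (lt_le_trans (mu_alpha_itv_gt0 n0 st)).
apply: le_measure; rewrite ?inE// => x /=; rewrite !in_itv/= => /andP[->].
exact: ltW.
Qed.

Lemma mu_alpha_itv_le s t : s <= t ->
  (mu `]s, t] <= (alpha_cst n alpha * (t - s))%:E)%E.
Proof.
move=> st.
apply: (@le_trans _ _ (\int[leb]_(x in `]s, t]) cst (alpha_cst n alpha)%:E x)%E).
  apply: ge0_le_integral => //=.
  - by move=> x _; rewrite lee_fin alpha_pdf_ge0.
  - by apply/measurable_EFinP; exact: measurable_alpha_pdf.
  - by move=> x _; rewrite lee_fin ler_pdivrMr ?alpha_fun_gt0// ler_peMr
      ?alpha_cst_ge0// alpha_fun_ge1.
rewrite integral_cst//= lebesgue_measure_itv/= lte_fin.
case: ltP => _; first by rewrite -EFinB -EFinM.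
by rewrite mule0 lee_fin mulr_ge0 ?alpha_cst_ge0// subr_ge0.
Qed.

Lemma continuous_mu_alpha : (0 < n)%N ->
  continuous (fun t : R => fine (mu `]-oo, t])).
Proof.
move=> n0; have c0 := alpha_cst_gt0 n0; set F := fun t : R => _.
have FB s t : s <= t -> `|F t - F s| <= alpha_cst n alpha * (t - s).
  move=> st; rewrite /F (mu_alpha_itvNyc st) fineD ?mu_alpha_fin_num//.
  rewrite addrAC subrr add0r ger0_norm ?fine_ge0//.
  by rewrite -lee_fin fineK ?mu_alpha_fin_num// mu_alpha_itv_le.
have FB' s t : `|F t - F s| <= alpha_cst n alpha * `|t - s|.
  have [st|/ltW ts] := leP s t; first by rewrite (ger0_norm (_ : 0 <= t - s)) ?subr_ge0// FB.
  by rewrite distrC (distrC t) (ger0_norm (_ : 0 <= s - t)) ?subr_ge0// FB.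
move=> t; apply/cvgrPdist_le => /= e e0.
near=> s.
apply: (le_trans (FB' _ _)).
rewrite mulrC -ler_pdivlMr//.
near: s; apply: cvgr_dist_le; first exact: cvg_id.
by rewrite divr_gt0.
Unshelve. all: by end_near. Qed.

Lemma g_alpha_exists a b : (0 < n)%N -> a < b -> exists t, is_g_alpha n alpha a b t.
Proof.
move=> n0 ab.
have v0 := mu_alpha_itv_gt0 n0 ab.
have [k hk] : exists k : nat, (mu `]-oo, (- k%:R)%R] < mu `]a, b[)%E.
  have cv : (mu \o (fun k : nat => `]-oo, (- k%:R)%R]%classic)) @ \oo --> 0%E.
    rewrite -mu0.
    have <- : \bigcap_k `]-oo, (- k%:R)%R]%classic = set0 :> set R.
      rewrite -subset0 => t /(_ (Num.bound `|t|) I).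
      rewrite /= in_itv/= leNgt => /negP; apply; rewrite ltrNl.
      by rewrite (le_lt_trans (ler_norm _))// normrN archi_boundP.
    apply: nonincreasing_cvg_mu => //=.
    + by rewrite ltey_eq mu_alpha_fin_num.
    + exact: bigcap_measurable.
    + move=> m l ml; apply/subsetPset => x/=; rewrite !in_itv => /le_trans; apply.
      by rewrite lerN2 ler_nat.
  have fv : mu `]a, b[ \is a fin_num by rewrite mu_alpha_fin_num.
  move: cv => /fine_cvgP[_ /cvgr_lt cv].
  have {}v0 : 0 < fine (mu `]a, b[) by rewrite fine_gt0// v0 ltey_eq fv.
  have [N _ /(_ N (leqnn N))/= hN] := cv _ v0.
  by exists N; rewrite -(fineK fv) -(fineK (mu_alpha_fin_num n0 (measurable_itv `]-oo, (- N%:R)%R]))) lte_fin.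
have vb : (mu `]a, b[ <= mu `]-oo, b])%E.
  apply: le_measure; rewrite ?inE//.
  by move=> x /=; rewrite !in_itv/= => /andP[_ /ltW].
have kb : - k%:R <= b :> R.
  rewrite leNgt; apply/negP => /(mu_alpha_itvNyc_lt n0) bk.
  by have := lt_trans (le_lt_trans vb bk) hk; rewrite ltxx.
have fin A : measurable A -> mu A \is a fin_num by exact: mu_alpha_fin_num.
have [||t _ Ft] := @IVT R (fun t => fine (mu `]-oo, t])) _ _ (fine (mu `]a, b[)) kb.
- by apply: continuous_subspaceT; exact: continuous_mu_alpha.
- have [h1 h2] := (fine_le (fin _ (measurable_itv _)) (fin _ (measurable_itv _)) (ltW hk),
    fine_le (fin _ (measurable_itv _)) (fin _ (measurable_itv _)) vb).
  by rewrite ge_min le_max h1 h2 orbT.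
- by exists t; rewrite /is_g_alpha -!/(mu _) -[LHS]fineK ?fin// Ft fineK ?fin.
Qed.

Lemma g_alpha_unique a b s t : (0 < n)%N ->
  is_g_alpha n alpha a b s -> is_g_alpha n alpha a b t -> s = t.
Proof.
rewrite /is_g_alpha -!/(mu _) => n0 <- ts.
by have [st|st|//] := ltgtP s t; have := mu_alpha_itvNyc_lt n0 st; rewrite ts ltxx.
Qed.

Lemma g_alphaP a b : (0 < n)%N -> a < b ->
  is_g_alpha n alpha a b (g_alpha n alpha a b).
Proof. by move=> n0 ab; exact: xgetPex (g_alpha_exists n0 ab). Qed.

End alpha_measure.

(* Main.v *)
(** Let [F] and [f] be the distribution function and the density of the measure,
[Q] the inverse of [F], and [I p = f (Q p)].  Since [g(a - r, b + r)] equals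
[Q (F (b + r) - F (a - r))], its derivative in [r] is
[(f (a - r) + f (b + r)) / f (g(a - r, b + r))].  With [p = F a] and
[q = 1 - F b], symmetry gives [f (g(a, b)) = I (p + q)], so the two claims
follow from [I (p + q) <= 2^(1/n) (I p + I q)], and from
[I (p + q) <= I p + I q] when [p + q >= 1/2].

The first bound holds because [J = I^(n/(n+1))] is concave and nonnegative,
hence subadditive, and by convexity of [t^((n+1)/n)].  For the second one, [I]
increases on [(0, 1/2]] and decreases afterwards, which leaves
[I (1/2) <= I p + I (1/2 - p)].  The right-hand side increases on [(0, 1/4]],
since [I'] at [F x] is [-(n+1) x / (S + x^2)] with [S = 1 + alpha^2], and
[Q p * Q (1/2 - p) <= S]; this last bound compares the mass of [(z, 0)] with
that of its image under the inversion [x |-> S / x]. *)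
Require Import Defs.
From HB Require Import structures.
From mathcomp Require Import all_boot all_order all_algebra.
From mathcomp Require Import all_classical all_reals all_analysis.
From mathcomp Require Import measurable_realfun ring lra.
Import Order.TTheory GRing.Theory Num.Theory.
Import numFieldNormedType.Exports.
Local Open Scope classical_set_scope.
Local Open Scope ring_scope.

Set Implicit Arguments.
Unset Strict Implicit.
Unset Printing Implicit Defensive.

(** * Calculus and power-mean preliminaries *)

Lemma is_derive_ge0_le (R : realType) (f df : R -> R) (a b : R) : a <= b ->
  (forall x, a <= x <= b -> is_derive x 1 f (df x)) ->
  (forall x, a <= x <= b -> 0 <= df x) -> f a <= f b.
Proof.
move=> ab fdf df0.
have [|//|c cab fab] := @MVT_segment R f df a b ab.
- move=> x; rewrite in_itv/= => /andP[/ltW ax /ltW xb].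
  by apply: fdf; rewrite ax.
- apply: derivable_within_continuous => x; rewrite in_itv/= => xab.
  by have [] := fdf x xab.
- rewrite -subr_ge0 fab mulr_ge0 ?subr_ge0//; apply: df0.
  by move: cab; rewrite in_itv.
Qed.

(** Lets [t] tend to 0 in bounds whose other terms involve [Q t], which is a default value at
    [t = 0]. *)
Lemma le_of_continuous_right (R : realType) (f : R -> R) (x y d : R) : 0 < d ->
  {for x, continuous f} -> (forall t, 0 < t <= d -> f (x + t) <= y) -> f x <= y.
Proof.
move=> d0 cf fy; rewrite leNgt; apply/negP => yx.
have : \forall z \near x, y < f z by exact: cvgr_gt cf _ yx.
move=> /nbhs_ballP[e /= e0 he].
pose t := Num.min d (e / 2).
have t0 : 0 < t by rewrite lt_min d0 divr_gt0.
have te : t < e by rewrite gt_min; apply/orP; right; lra.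
have : y < f (x + t).
  by apply: he; rewrite /ball/= opprD addNKr normrN gtr0_norm.
by apply/negP; rewrite -leNgt fy// t0 ge_min lexx.
Qed.

Lemma is_derive_comp_affine (R : realType) (f : R -> R) (a b t l : R) :
  is_derive (a + b * t) 1 f l ->
  is_derive t 1 (fun t => f (a + b * t)) (b * l).
Proof.
move=> df; have dg : is_derive t 1 (fun t => a + b * t) b.
  by apply: is_derive_eq; rewrite /GRing.scale/=; ring.
have := @is_derive1_comp R f (fun t => a + b * t) t _ _ df dg.
by rewrite mulrC.
Qed.

(** Convexity of the power [p = (n+1)/n], applied to [a ^+ n] and [b ^+ n]; the constant is
    2^(p-1). *)
Lemma expr_le_power_mean (R : realType) (n : nat) (a b d : R) : (0 < n)%N ->
  0 <= a -> 0 <= b -> 0 <= d -> d ^+ n <= a ^+ n + b ^+ n ->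
  d ^+ n.+1 <= 2 `^ n%:R^-1 * (a ^+ n.+1 + b ^+ n.+1).
Proof.
move=> n0 a0 b0 d0 dab; pose p : R := n.+1%:R / n%:R.
have nN0 : n%:R != 0 :> R by rewrite pnatr_eq0 -lt0n.
have p1 : 1 <= p by rewrite ler_pdivlMr ?ltr0n// mul1r ler_nat.
have pE : p = n%:R^-1 + 1 by rewrite /p -natr1 mulrDl divff// mul1r addrC.
have XE (x : R) : 0 <= x -> x ^+ n.+1 = (x ^+ n) `^ p.
  move=> x0; rewrite -[x ^+ n]powR_mulrn// -powRrM mulrCA divff// mulr1.
  by rewrite powR_mulrn.
have A0 := exprn_ge0 n a0; have B0 := exprn_ge0 n b0.
rewrite !XE//; apply: (@le_trans _ _ ((a ^+ n + b ^+ n) `^ p)).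
  apply: ge0_ler_powR; rewrite ?nnegrE ?addr_ge0 ?exprn_ge0//.
  exact: le_trans ler01 p1.
have half (x y : R) : 0 <= x -> 0 <= y ->
    (2^-1 * x + 2^-1 * y) `^ p <= 2^-1 * x `^ p + 2^-1 * y `^ p.
  move=> x0 y0; rewrite {2 4}(_ : 2^-1 = 1 - 2^-1); last by lra.
  by apply: (convex_powR p1 (Itv01 _ _)) => //=;
    rewrite ?inE/= ?in_itv/= ?andbT// ?invr_ge0// invf_le1 ?ler1n.
(* The factors 2 cancel the weights on the left and give 2^p on the right, half of which is
   2^(1/n). *)
have := half (2 * a ^+ n) (2 * b ^+ n)
  (mulr_ge0 (ler0n _ 2) A0) (mulr_ge0 (ler0n _ 2) B0).
have p2 : 2 `^ p = 2 `^ n%:R^-1 * 2 :> R.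
  by rewrite pE powRD ?pnatr_eq0 ?implybT// powRr1.
by rewrite !mulKf// !powRM// p2; lra.
Qed.

(** * Density, distribution function and symmetry *)

Section density.
Context {R : realType}.
Variables (n : nat) (n_gt0 : (0 < n)%N) (alpha : R).
Local Notation leb := (@lebesgue_measure R).
Local Notation c := (alpha_cst n alpha).
Local Notation f := (alpha_pdf n alpha).
Local Notation S := (1 + alpha ^+ 2).

Lemma scale_gt0 : 0 < S.
Proof. by have := sqr_ge0 alpha; lra. Qed.

(** The density is [c] times an integer power of this function, so derivatives avoid real
    exponents. *)
Definition winv (x : R) : R := (Num.sqrt (S + x ^+ 2))^-1.
Local Notation w := winv.

Lemma winv_arg_gt0 x : 0 < S + x ^+ 2.
Proof. by rewrite ltr_wpDr ?sqr_ge0 ?scale_gt0. Qed.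

Lemma winv_gt0 x : 0 < w x.
Proof. by rewrite invr_gt0 sqrtr_gt0 winv_arg_gt0. Qed.

Lemma winv_sqr x : w x ^+ 2 * (S + x ^+ 2) = 1.
Proof.
rewrite /winv exprVn sqr_sqrtr ?mulVf// ?gt_eqF ?winv_arg_gt0//.
exact/ltW/winv_arg_gt0.
Qed.

Lemma winvN x : w (- x) = w x.
Proof. by rewrite /winv sqrrN. Qed.

Lemma alpha_pdfE x : f x = c * w x ^+ n.+1.
Proof.
rewrite /alpha_pdf /alpha_fun /winv exprVn; congr (_ / _).
rewrite -powR12_sqrt ?(ltW (winv_arg_gt0 x))//.
by rewrite -(powR_mulrn n.+1) ?powR_ge0// -powRrM mulrC.
Qed.

Lemma is_derive_winv (x : R) : is_derive x 1 w (- x * w x ^+ 3).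
Proof.
have g0 := winv_arg_gt0 x.
have d1 : is_derive x 1 (fun x : R => S + x ^+ 2) (2 * x).
  by apply: is_derive_eq; rewrite /GRing.scale/=; ring.
have d2 := @is_derive1_comp R Num.sqrt (fun x => S + x ^+ 2) x _ _
  (is_derive1_sqrt g0) d1.
have s0 : Num.sqrt (S + x ^+ 2) != 0 by rewrite gt_eqF// sqrtr_gt0.
have d3 := @is_deriveV R (Num.sqrt \o (fun x => S + x ^+ 2)) x _ _ s0 d2.
apply: is_derive_eq.
rewrite /w /GRing.scale/=; field; rewrite ?s0.
by [].
Qed.

Lemma continuous_alpha_pdf : continuous f.
Proof.
move=> x; apply/differentiable_continuous/derivable1_diffP.
rewrite (_ : f = c \*: w ^+ n.+1).
  by have [] := is_deriveZ c (is_deriveX n.+1 (is_derive_winv x)).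
by apply: funext => y; rewrite alpha_pdfE /= fctE.
Qed.

Definition cdf_alpha (t : R) : R := fine (mu_alpha n alpha `]-oo, t]).
Local Notation F := cdf_alpha.

Lemma integrable_alpha_pdf : leb.-integrable setT (EFin \o f).
Proof.
have := integrableZl measurableT c (integrable_alpha_funV alpha n_gt0).
by apply: eq_integrable.
Qed.

Lemma is_derive_cdf (t : R) : is_derive t 1 F (f t).
Proof.
(* Ending at [t + 1] makes [t] an interior point for [continuous_FTC1]. *)
have int : leb.-integrable `]-oo, t + 1] (EFin \o f).
  by apply: integrableS integrable_alpha_pdf.
have t1 : t < t + 1 by rewrite ltrDl.
have [|dF D] := continuous_FTC1 t1 int _ (@continuous_alpha_pdf t).
  by rewrite ltNyr.
by apply: DeriveDef; [exact: dF|rewrite -derive1E D].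
Qed.

Lemma continuous_cdf : continuous F.
Proof. exact: continuous_mu_alpha. Qed.

Lemma cdf_lt s t : s < t -> F s < F t.
Proof.
move=> st; rewrite /F -lte_fin !fineK ?mu_alpha_fin_num//.
exact: mu_alpha_itvNyc_lt.
Qed.

Lemma cdf_lt_mono : {mono F : x y / x < y}.
Proof. exact/leW_mono/le_mono/cdf_lt. Qed.

Lemma cdf_le_mono : {mono F : x y / x <= y}.
Proof. exact/le_mono/cdf_lt. Qed.

(** The density is even and the total mass is 1. *)
Lemma cdf_sym t : F (- t) = 1 - F t.
Proof.
have mu1 : (mu_alpha n alpha `]-oo, t] + mu_alpha n alpha `]t, +oo[ = 1)%E.
  rewrite -(mu_alpha_setT alpha n_gt0) -measureU//=.
    by rewrite -itv_bndbnd_setU// set_itvNyy.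
  rewrite -subset0 => x [] /=; rewrite !in_itv/= andbT => xt tx.
  by move: (le_lt_trans xt tx); rewrite ltxx.
have muN : mu_alpha n alpha `]-oo, - t] = mu_alpha n alpha `]t, +oo[.
  rewrite /mu_alpha ge0_integration_by_substitutionNy.
  - rewrite integral_itv_obnd_cbnd; last first.
      by apply/measurable_EFinP; exact: measurable_alpha_pdf.
    apply: eq_integral => x _; congr EFin.
    by rewrite /= !alpha_pdfE winvN.
  - by apply: continuous_subspaceT; exact: continuous_alpha_pdf.
  - by move=> x _; exact: alpha_pdf_ge0.
apply/eqP; rewrite eq_sym subr_eq addrC -eqe EFinD /F muN.
by rewrite !fineK ?mu_alpha_fin_num// mu1.
Qed.

Lemma cdf_gt0 t : 0 < F t.
Proof.
apply: (@le_lt_trans _ _ (F (t - 1))); last by rewrite cdf_lt// gtrBl.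
by apply: fine_ge0; exact: measure_ge0.
Qed.

Lemma cdf_lt1 t : F t < 1.
Proof. by have := cdf_gt0 (- t); rewrite cdf_sym subr_gt0. Qed.

Lemma cdf0 : F 0 = 1 / 2.
Proof. by have := cdf_sym 0; rewrite oppr0; lra. Qed.

Lemma mu_alpha_itvE a b : a < b -> mu_alpha n alpha `]a, b[ = (F b - F a)%:E.
Proof.
move=> ab; rewrite /F.
have -> : mu_alpha n alpha `]a, b[ = mu_alpha n alpha `]a, b].
  rewrite /mu_alpha integral_itv_bndo_bndc//.
  by apply/measurable_EFinP; exact: measurable_alpha_pdf.
rewrite (mu_alpha_itvNyc n alpha (ltW ab)) fineD ?mu_alpha_fin_num//.
by rewrite addrAC subrr add0r fineK// mu_alpha_fin_num.
Qed.

Lemma is_g_alphaE a b t : a < b ->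
  is_g_alpha n alpha a b t <-> F t = F b - F a.
Proof.
move=> ab; rewrite /is_g_alpha -!/(mu_alpha _ _ _) (mu_alpha_itvE ab).
rewrite -[X in X = _]fineK ?mu_alpha_fin_num//.
by split => [[]|<-].
Qed.

(** The density is at most [c], so an interval of length [e / c / 2] has mass at most [e / 2]; the
    half-line of equal mass supplies [t]. *)
Lemma cdf_small e : 0 < e -> exists t, F t < e.
Proof.
move=> e0; have c0 := alpha_cst_gt0 alpha n_gt0.
have ab : 0 < e / c / 2 by rewrite !divr_gt0.
have [t /(is_g_alphaE _ ab) Ft] := g_alpha_exists alpha n_gt0 ab.
exists t; rewrite Ft -lte_fin -mu_alpha_itvE//.
apply: (@le_lt_trans _ _ (mu_alpha n alpha `]0, e / c / 2])).
  apply: le_measure; rewrite ?inE// => x /=.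
  by rewrite !in_itv/= => /andP[->/ltW].
apply: (le_lt_trans (mu_alpha_itv_le _ _ (ltW ab))).
rewrite lte_fin subr0 mulrA mulrCA divff ?gt_eqF//; lra.
Qed.

(** * Inverting the distribution function *)

Lemma cdf_surj p : 0 < p < 1 -> exists t, F t = p.
Proof.
move=> /andP[p0 p1].
have [s Fs] := cdf_small p0.
have [t Ft] : exists t, F t < 1 - p by apply: cdf_small; rewrite subr_gt0.
have {}Ft : p < F (- t) by rewrite cdf_sym; lra.
have st : s <= - t by rewrite -cdf_le_mono ltW// (lt_trans Fs).
have [||x _ Fx] := @IVT R F s (- t) p st; last by exists x.
  by apply: continuous_subspaceT; exact: continuous_cdf.
by rewrite ge_min le_max (ltW Fs) (ltW Ft) orbT.
Qed.

(* The default value 0 is irrelevant for [0 < p < 1]: see [quantileK]. *)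
Definition quantile (p : R) : R := xget 0 [set t | F t = p].
Local Notation Q := quantile.

Lemma quantileK p : 0 < p < 1 -> F (Q p) = p.
Proof. by move=> /cdf_surj tp; exact: (xgetPex 0 tp). Qed.

Lemma cdfK : cancel F Q.
Proof.
move=> t; apply: (inc_inj cdf_le_mono).
by rewrite quantileK// cdf_gt0 cdf_lt1.
Qed.

Lemma is_derive_quantile (p : R) : 0 < p < 1 -> is_derive p 1 Q (f (Q p))^-1.
Proof.
move=> p01; rewrite -{1}(quantileK p01).
apply: is_derive_inverse (is_derive_cdf _) _.
- by apply: (@nearW _ (nbhs (Q p))) => t; exact: cdfK.
- by apply: (@nearW _ (nbhs (Q p))) => t; exact: continuous_cdf.
- by rewrite gt_eqF// alpha_pdf_gt0.
Qed.

Lemma quantile_le p q : 0 < p -> q < 1 -> p <= q -> Q p <= Q q.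
Proof. by move=> p0 q1 pq; rewrite -cdf_le_mono !quantileK//; lra. Qed.

Lemma quantile_sym p : 0 < p < 1 -> Q (1 - p) = - Q p.
Proof.
by move=> p01; rewrite -[RHS]cdfK cdf_sym quantileK.
Qed.

Lemma g_alphaE a b : a < b -> g_alpha n alpha a b = Q (F b - F a).
Proof.
move=> ab; apply: (inc_inj cdf_le_mono).
have /(is_g_alphaE _ ab) -> := g_alphaP alpha n_gt0 ab.
rewrite quantileK// subr_gt0 cdf_lt//=.
by have := cdf_gt0 a; have := cdf_lt1 b; lra.
Qed.

(* The profile [I] is [c * u ^+ n.+1], and [J] is [u ^+ n] up to a constant. *)
Definition profile_root (p : R) : R := w (Q p).
Local Notation u := profile_root.

Lemma alpha_pdf_quantile p : f (Q p) = c * u p ^+ n.+1.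
Proof. exact: alpha_pdfE. Qed.

Lemma profile_root_gt0 p : 0 < u p.
Proof. exact: winv_gt0. Qed.

(** * Derivatives of powers of the profile root *)

Lemma is_derive_profile_root (p : R) : 0 < p < 1 ->
  is_derive p 1 u (- (Q p * u p ^+ 2 / (c * u p ^+ n))).
Proof.
move=> p01; have u0 := profile_root_gt0 p.
have c0 := alpha_cst_gt0 alpha n_gt0.
have h := @is_derive1_comp R w Q p _ _ (is_derive_winv (Q p))
  (is_derive_quantile p01).
apply: is_derive_eq; rewrite alpha_pdfE -/(u p) (exprS _ n); field.
by rewrite !gt_eqF ?exprn_gt0.
Qed.

(** The unsimplified quotient serves two cases: [m = n] gives slope [- (n / c) Q u], and [m = n + 1]
    gives [- ((n + 1) / c) Q u^2]. *)
Lemma is_derive_profile_rootX (p : R) (m : nat) : 0 < p < 1 -> (0 < m)%N ->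
  is_derive p 1 (fun p => u p ^+ m)
    (- (m%:R / c * Q p * u p ^+ m.+1 / u p ^+ n)).
Proof.
move=> p01 m0; have u0 := profile_root_gt0 p.
have c0 := alpha_cst_gt0 alpha n_gt0.
have h := is_deriveX m (is_derive_profile_root p01).
rewrite (_ : (fun p => _) = u ^+ m); last by apply: funext => t; rewrite fctE.
apply: is_derive_eq; rewrite /GRing.scale/=; case: m m0 {h} => //= m _.
rewrite (exprS _ m.+1) (exprS _ m); field.
by rewrite !gt_eqF ?exprn_gt0.
Qed.

(** * Monotonicity, and subadditivity from concavity *)

Lemma winv_le x y : y ^+ 2 <= x ^+ 2 -> w x <= w y.
Proof.
move=> yx; rewrite lef_pV2 ?posrE ?sqrtr_gt0 ?winv_arg_gt0//.
by rewrite ler_wsqrtr ?lerD2l.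
Qed.

(** By [winv_sqr] the derivative of [z * w z] is [S * w z ^+ 3]. Composed with [Q], this makes the
    slope of [u ^+ n] nonincreasing, hence [u ^+ n] concave. *)
Lemma mul_winv_le x y : x <= y -> x * w x <= y * w y.
Proof.
move=> xy; apply: (@is_derive_ge0_le R (fun z => z * w z)
  (fun z => S * w z ^+ 3) x y xy) => z _.
  have h := is_deriveM (is_derive_id z 1) (is_derive_winv z).
  apply: is_derive_eq; rewrite /GRing.scale/=.
  have := congr1 ( *%R (w z)) (winv_sqr z); lra.
by rewrite mulr_ge0 ?exprn_ge0 ?ltW ?winv_gt0 ?scale_gt0.
Qed.

Lemma quantile_half : Q (1 / 2) = 0.
Proof. by rewrite -cdf0 cdfK. Qed.

Lemma profile_root_sym p : 0 < p < 1 -> u (1 - p) = u p.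
Proof. by move=> p01; rewrite /u quantile_sym// winvN. Qed.

Lemma profile_root_le p q : 0 < p -> p <= q -> q <= 1 / 2 -> u p <= u q.
Proof.
move=> p0 pq q2; apply: winv_le.
(* Both quantiles are nonpositive here, so squaring reverses their order. *)
have := quantile_le p0 (_ : q < 1) pq; have := quantile_le (_ : 0 < q) _ q2.
rewrite quantile_half; nra.
Qed.


(** By concavity [u t ^+ n - u (p + t) ^+ n] is nondecreasing in [t]; its value at [q] is compared
    with the limit at 0, after discarding [u t ^+ n >= 0]. *)
Lemma profile_root_subadd (p q : R) : 0 < p -> 0 < q -> p + q < 1 ->
  u (p + q) ^+ n <= u p ^+ n + u q ^+ n.
Proof.
move=> p0 q0 pq1; have c0 := alpha_cst_gt0 alpha n_gt0.
have dJ (t : R) : 0 < t < 1 ->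
    is_derive t 1 (fun t => u t ^+ n) (- (n%:R / c * (Q t * u t))).
  move=> t01; have h := is_derive_profile_rootX t01 n_gt0.
  apply: is_derive_eq; rewrite exprS; field.
  by rewrite !gt_eqF ?exprn_gt0 ?profile_root_gt0.
have concave (t : R) : 0 < t <= q ->
    u t ^+ n - u (p + t) ^+ n <= u q ^+ n - u (p + q) ^+ n.
  move=> /andP[t0 tq].
  apply: (@is_derive_ge0_le R (fun t => u t ^+ n - u (p + t) ^+ n)
    (fun t => - (n%:R / c * (Q t * u t)) + n%:R / c * (Q (p + t) * u (p + t)))
    t q tq) => s /andP[ts sq].
    have d1 : 0 < s < 1 by lra.
    have d2 : 0 < p + 1 * s < 1 by lra.
    have h := is_deriveB (dJ _ d1) (is_derive_comp_affine (dJ _ d2)).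
    rewrite (_ : (fun t => _) = (fun t => u t ^+ n) -
      (fun t => u (p + 1 * t) ^+ n)); last first.
      by apply: funext => r; rewrite !fctE mul1r.
    by apply: is_derive_eq; rewrite !mul1r opprK.
  rewrite addrC subr_ge0 ler_wpM2l ?divr_ge0 ?(ltW c0)//.
  by apply: mul_winv_le; apply: quantile_le; lra.
rewrite -subr_le0 -lerBrDr.
suff : - u p ^+ n <= u q ^+ n - u (p + q) ^+ n by lra.
apply: (@le_of_continuous_right R (fun p => - u p ^+ n) p _ q q0).
  apply: continuousN; apply/differentiable_continuous/derivable1_diffP.
  by have /dJ[] : 0 < p < 1 by lra.
move=> t tq; apply: le_trans (concave t tq).
by rewrite -[leLHS]add0r lerD2r exprn_ge0 ?ltW ?profile_root_gt0.
Qed.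


(** * The inversion [x |-> S / x] *)

Lemma winv_inversion z : z < 0 -> w (S / z) ^+ 2 = z ^+ 2 / S * w z ^+ 2.
Proof.
move=> z0; have S0 := scale_gt0; have e := winv_sqr (S / z).
have e' := winv_sqr z; have z2 : 0 < z ^+ 2 by rewrite exprn_even_gt0//= lt_eqF.
have k0 : 0 < S + (S / z) ^+ 2 := winv_arg_gt0 _.
apply: (mulIf (lt0r_neq0 k0)); rewrite e.
rewrite -[LHS]e'; field.
by rewrite lt_eqF// gt_eqF.
Qed.

(** Two of the [n + 1] factors [w] absorb the Jacobian exactly ([winv_inversion]), so [n = 1] is an
    equality; the other [n - 1] compare because [|z| <= |S / z|]. *)
Lemma alpha_pdf_inversion_le z : z < 0 -> z ^+ 2 <= S ->
  f (S / z) * S / z ^+ 2 <= f z.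
Proof.
move=> z0 zS; have S0 := scale_gt0; have c0 := alpha_cst_gt0 alpha n_gt0.
have z2 : 0 < z ^+ 2 by rewrite exprn_even_gt0//= lt_eqF.
have le : w (S / z) <= w z.
  apply: winv_le; rewrite expr_div_n ler_pdivlMr// (expr2 S).
  by rewrite ler_pM// ltW.
rewrite !alpha_pdfE -!mulrA ler_pM2l// mulrA ler_pdivrMr//.
case: n n_gt0 => // m _.
rewrite -(addn2 m) !(exprD _ m 2) winv_inversion//.
rewrite (_ : _ * S = w (S / z) ^+ m * (w z ^+ 2 * z ^+ 2)); last first.
  by field; rewrite gt_eqF.
rewrite -[leRHS]mulrA; apply: ler_wpM2r; first by rewrite mulr_ge0 ?sqr_ge0.
by apply: lerXn2r; rewrite ?nnegrE// ltW// winv_gt0.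
Qed.

(** When [z^2 <= S], the left-hand side is nondecreasing as [z] rises to 0 and tends to [F 0].
    Exchanging [z] and [S / z] covers the other case. *)
Lemma cdf_inversion_le z : z < 0 -> F z + F (S / z) <= 1 / 2.
Proof.
have S0 := scale_gt0.
wlog zS : z / z ^+ 2 <= S => [hw z0|z0].
  have [/hw/(_ z0)//|Sz] := leP (z ^+ 2) S.
  have Sz0 : S / z < 0 by rewrite pmulr_rlt0// invr_lt0.
  have SSz : S / (S / z) = z by field; rewrite lt_eqF// gt_eqF.
  rewrite addrC -{2}SSz; apply: hw => //.
  by rewrite expr_div_n ler_pdivrMr ?(lt_trans S0)// (expr2 S) ler_pM2l// ltW.
rewrite leNgt; apply/negP; rewrite -subr_gt0 => /cdf_small[t Ft].
(* Replaces the limit: [z'] lies in [[z, 0)], and [S / z' = t'] is so far left that [F t'] is below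
   the assumed excess over 1/2. *)
pose t' := Num.min t (S / z); pose z' := S / t'.
have Sz0 : S / z < 0 by rewrite pmulr_rlt0// invr_lt0.
have t'0 : t' < 0 by rewrite gt_min Sz0 orbT.
have zz' : z <= z'.
  by rewrite ler_ndivlMr// mulrC -ler_ndivlMr// ge_min lexx orbT.
have z'0 : z' < 0 by rewrite pmulr_rlt0// invr_lt0.
have St' : S / z' = t' by rewrite /z'; field; rewrite lt_eqF// gt_eqF.
have : F z + F (S / z) <= F z' + F (S / z').
  apply: (@is_derive_ge0_le R (fun z => F z + F (S / z))
    (fun z => f z - f (S / z) * S / z ^+ 2) z z' zz') => y /andP[zy yz'].
    have y0 : y < 0 by lra.
    have dV := @is_deriveV R id y _ _ (ltr0_neq0 y0) (is_derive_id y 1).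
    have dSV := is_deriveZ S dV.
    have h := is_deriveD (is_derive_cdf y)
      (@is_derive1_comp R F _ y _ _ (is_derive_cdf _) dSV).
    rewrite (_ : (fun z => _) = F + (F \o (S \*: (fun y => y^-1)))) //.
    by apply: is_derive_eq; rewrite /GRing.scale/=; field; rewrite lt_eqF.
  rewrite subr_ge0 alpha_pdf_inversion_le//; nra.
rewrite St'; have : F t' <= F t by rewrite cdf_le_mono ge_min lexx.
have : F z' < F 0 by rewrite cdf_lt.
rewrite cdf0; lra.
Qed.

(** For [y = Q (1 / 2 - p)], inversion gives [S / y <= Q p]; multiplying by [y < 0] reverses it. *)
Lemma quantile_mul_le p : 0 < p < 1 / 2 -> Q p * Q (1 / 2 - p) <= S.
Proof.
move=> p2; have [p1 q1] : 0 < p < 1 /\ 0 < 1 / 2 - p < 1 by split; lra.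
have y0 : Q (1 / 2 - p) < 0 by rewrite -cdf_lt_mono quantileK// cdf0; lra.
have := cdf_inversion_le y0; rewrite quantileK// => h.
have : S / Q (1 / 2 - p) <= Q p by rewrite -cdf_le_mono quantileK//; lra.
by rewrite ler_ndivrMr.
Qed.

(** * Subadditivity of the profile for sums at least 1/2 *)

Lemma profile_half_le p : 0 < p < 1 / 2 ->
  u (1 / 2) ^+ n.+1 <= u p ^+ n.+1 + u (1 / 2 - p) ^+ n.+1.
Proof.
have c0 := alpha_cst_gt0 alpha n_gt0.
wlog p4 : p / p <= 1 / 4 => [hw p2|p2].
  have [/hw/(_ p2)//|p4] := leP p (1 / 4).
  have pE : 1 / 2 - (1 / 2 - p) = p by ring.
  by rewrite addrC -{2}pE; apply: hw; lra.
have dI (t : R) : 0 < t < 1 -> is_derive t 1 (fun t => u t ^+ n.+1)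
    (- (n.+1%:R / c * (Q t * u t ^+ 2))).
  move=> t01; have h := is_derive_profile_rootX t01 (ltn0Sn n).
  apply: is_derive_eq; rewrite !exprS; field.
  by rewrite !gt_eqF ?exprn_gt0 ?profile_root_gt0.
have incr (t : R) : 0 < t <= p -> u t ^+ n.+1 + u (1 / 2 - t) ^+ n.+1 <=
    u p ^+ n.+1 + u (1 / 2 - p) ^+ n.+1.
  move=> /andP[t0 tp].
  apply: (@is_derive_ge0_le R (fun t => u t ^+ n.+1 + u (1 / 2 - t) ^+ n.+1)
    (fun t => n.+1%:R / c *
      (Q (1 / 2 - t) * u (1 / 2 - t) ^+ 2 - Q t * u t ^+ 2))
    t p tp) => s /andP[ts sp].
    have d1 : 0 < s < 1 by lra.
    have d2 : 0 < 1 / 2 + (- 1) * s < 1 by lra.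
    have h := is_deriveD (dI _ d1) (is_derive_comp_affine (dI _ d2)).
    rewrite (_ : (fun t => _) = (fun t => u t ^+ n.+1) +
      (fun t => u (1 / 2 + (- 1) * t) ^+ n.+1)); last first.
      by apply: funext => r; rewrite !fctE mulN1r.
    by apply: is_derive_eq; rewrite !mulN1r; ring.
  rewrite mulr_ge0 ?divr_ge0 ?(ltW c0)// subr_ge0.
  have xy : Q s <= Q (1 / 2 - s) by apply: quantile_le; lra.
  have xyS : Q s * Q (1 / 2 - s) <= S by apply: quantile_mul_le; lra.
  have := winv_sqr (Q s); have := winv_sqr (Q (1 / 2 - s)).
  rewrite -/(u s) -/(u (1 / 2 - s)).
  have := sqr_ge0 (u s); have := sqr_ge0 (u (1 / 2 - s)).
  move: (Q s) (Q (1 / 2 - s)) (u s ^+ 2) (u (1 / 2 - s) ^+ 2) xy xyS.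
  move=> x y U V xy xyS V0 U0 eV eU.
  (* Here [U = 1 / (S + x^2)] and [V = 1 / (S + y^2)], so [y V - x U = (y - x) (S - x y) U V]. *)
  have e1 : y * V = y * V * (U * (S + x ^+ 2)) by rewrite eU mulr1.
  have e2 : x * U = x * U * (V * (S + y ^+ 2)) by rewrite eV mulr1.
  have : 0 <= (y - x) * (S - x * y) * (U * V).
    by rewrite !mulr_ge0// subr_ge0.
  lra.
apply: (@le_of_continuous_right R (fun p => u p ^+ n.+1) (1 / 2) _ p).
- by lra.
- apply/differentiable_continuous/derivable1_diffP.
  by have /dI[] : 0 < (1 / 2 : R) < 1 by lra.
- move=> t tp; apply: le_trans (incr t tp).
  (* The limit approaches 1/2 from the right, whereas [incr] involves [u (1 / 2 - t)]; symmetry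
     exchanges the two. *)
  rewrite -(@profile_root_sym (1 / 2 + t)); last by lra.
  rewrite (_ : 1 - (1 / 2 + t) = 1 / 2 - t); last by lra.
  by rewrite lerDr exprn_ge0 ?ltW ?profile_root_gt0.
Qed.

(** If [p] or [q] is at least 1/2, its term alone suffices, as the profile decreases there.
    Otherwise pass to 1/2 and use [1 / 2 - p <= q < 1 / 2]. *)
Lemma profile_subadd p q : 0 < p -> 0 < q -> p + q < 1 -> 1 / 2 <= p + q ->
  u (p + q) ^+ n.+1 <= u p ^+ n.+1 + u q ^+ n.+1.
Proof.
have uX_ge0 t : 0 <= u t ^+ n.+1 by rewrite exprn_ge0 ?ltW ?profile_root_gt0.
have uX_le s t : u s <= u t -> u s ^+ n.+1 <= u t ^+ n.+1.
  by move=> st; apply: lerXn2r; rewrite ?nnegrE ?(ltW (profile_root_gt0 _)).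
have decr s t : 1 / 2 <= s -> s <= t -> t < 1 -> u t ^+ n.+1 <= u s ^+ n.+1.
  move=> s2 st t1; apply: uX_le.
  rewrite -(@profile_root_sym t) -?(@profile_root_sym s); [|lra..].
  apply: profile_root_le; lra.
move=> p0 q0 pq1 pq2.
have [p2|p2] := leP (1 / 2) p.
  by rewrite (le_trans (decr p _ p2 _ pq1))// ?lerDl//; lra.
have [q2|q2] := leP (1 / 2) q.
  by rewrite (le_trans (decr q _ q2 _ pq1))// ?lerDr//; lra.
apply: (le_trans (decr (1 / 2) _ _ pq2 pq1)); first by [].
apply: (le_trans (profile_half_le _ : _ <= u p ^+ n.+1 + _)); first by lra.
rewrite lerD2l uX_le// profile_root_le; lra.
Qed.


(** The hypothesis says that [g] minus [k t] has nonnegative derivative in [t]. The two claims take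
    [k = 2^(-1/n)] and [k = 1]. *)
Lemma g_alpha_growth (a b k r : R) : a < b -> 0 <= r ->
  (forall t, 0 <= t <= r ->
    k * f (g_alpha n alpha (a - t) (b + t)) <= f (a - t) + f (b + t)) ->
  k * r <= g_alpha n alpha (a - r) (b + r) - g_alpha n alpha a b.
Proof.
move=> ab r0 kf; pose M t := F (b + t) - F (a - t).
have QM t : 0 <= t -> g_alpha n alpha (a - t) (b + t) = Q (M t).
  by move=> t0; apply: g_alphaE; lra.
have M01 t : 0 <= t -> 0 < M t < 1.
  move=> t0; rewrite subr_gt0 cdf_lt; last by lra.
  by have := cdf_lt1 (b + t); have := cdf_gt0 (a - t); rewrite /M; lra.
suff : Q (M 0) - k * 0 <= Q (M r) - k * r.
  by rewrite -!QM// subr0 addr0; lra.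
apply: (@is_derive_ge0_le R (fun t => Q (M t) - k * t)
  (fun t => (f (Q (M t)))^-1 * (f (b + t) + f (a - t)) - k) 0 r r0) => t tr.
  have t0 : 0 <= t by case/andP: tr.
  have dM : is_derive t 1 M (f (b + t) + f (a - t)).
    have h := is_deriveB
      (@is_derive_comp_affine R F b 1 t _ (is_derive_cdf _))
      (@is_derive_comp_affine R F a (- 1) t _ (is_derive_cdf _)).
    rewrite (_ : M = (fun t => F (b + 1 * t)) - (fun t => F (a + (- 1) * t))).
      by apply: is_derive_eq; rewrite !mul1r !mulN1r; ring.
    by apply: funext => s; rewrite !fctE mul1r mulN1r.
  have dQ := @is_derive1_comp R Q M t _ _ (is_derive_quantile (M01 t t0)) dM.
  have h := is_deriveB dQ (is_deriveZ k (is_derive_id t 1)).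
  rewrite (_ : (fun t => _) = (Q \o M) - (k \*: id)) //.
  by apply: is_derive_eq; rewrite /GRing.scale/= mulr1.
have t0 : 0 <= t by case/andP: tr.
have := kf t tr; rewrite QM// subr_ge0 mulrC => h.
by rewrite mulrC ler_pdivlMr ?alpha_pdf_gt0// mulrC addrC.
Qed.

(** * Profile inequalities at the endpoints *)

Section endpoints.
Variables (a b : R) (ab : a < b).
Let p := F a.
(** The upper tail [1 - F b], written as a value of [F] so that [cdfK] inverts it. *)
Let q := F (- b).

Lemma endpoints_gt0 : [/\ 0 < p, 0 < q & p + q < 1].
Proof.
split; rewrite ?cdf_gt0// /p /q cdf_sym.
by have := cdf_lt ab; lra.
Qed.

(** The interval has mass [1 - (p + q)], and the profile is symmetric about 1/2. *)
Lemma g_alpha_profile : f (g_alpha n alpha a b) = c * u (p + q) ^+ n.+1.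
Proof.
have [p0 q0 pq1] := endpoints_gt0.
rewrite g_alphaE// alpha_pdf_quantile -(@profile_root_sym (p + q)); last by lra.
by rewrite /p /q cdf_sym; congr (_ * u _ ^+ _); ring.
Qed.

Lemma endpoints_profile : f a + f b = c * (u p ^+ n.+1 + u q ^+ n.+1).
Proof. by rewrite !alpha_pdfE /u !cdfK winvN mulrDr. Qed.

Lemma alpha_pdf_endpoints_ge :
  (2 `^ n%:R^-1)^-1 * f (g_alpha n alpha a b) <= f a + f b.
Proof.
have [p0 q0 pq1] := endpoints_gt0.
rewrite mulrC ler_pdivrMr ?powR_gt0// g_alpha_profile endpoints_profile.
rewrite -mulrA ler_pM2l ?alpha_cst_gt0// mulrC.
by apply: expr_le_power_mean; rewrite ?(ltW (profile_root_gt0 _))//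
  profile_root_subadd.
Qed.

Lemma alpha_pdf_endpoints_half_ge :
  F b - F a <= 1 / 2 -> f (g_alpha n alpha a b) <= f a + f b.
Proof.
move=> ab2; have [p0 q0 pq1] := endpoints_gt0.
rewrite g_alpha_profile endpoints_profile ler_pM2l ?alpha_cst_gt0//.
by apply: profile_subadd => //; rewrite /p /q cdf_sym; lra.
Qed.

End endpoints.

End density.

Theorem theorem8 (R : realType) (n : nat) (hn : (1 <= n)%N)
    (alpha : R) (halpha : 0 <= alpha) (a b : R) (hab : a < b) :
  (forall r : R, 0 < r ->
     g_alpha n alpha (a - r) (b + r) - g_alpha n alpha a b
       >= r / 2 `^ (n%:R^-1))
  /\
  ((mu_alpha n alpha `]a, b[ < (1 / 2)%:E)%E ->
   exists2 r0 : R, 0 < r0 &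
     forall r : R, 0 < r <= r0 ->
       g_alpha n alpha (a - r) (b + r) - g_alpha n alpha a b >= r).
Proof.
split=> [r r0|].
  rewrite mulrC; apply: (g_alpha_growth hn) => //; first exact: ltW.
  by move=> t /andP[t0 _]; apply: (alpha_pdf_endpoints_ge hn) => //; lra.
rewrite mu_alpha_itvE// lte_fin => ab2.
pose F := cdf_alpha n alpha.
have [e e0 he] : exists2 e : R, 0 < e &
    forall t, 0 <= t <= e -> F (b + t) - F (a - t) <= 1 / 2.
  (* Half the gap to 1/2: moving each endpoint may add mass up to [d]. *)
  pose d : R := (1 / 2 - (F b - F a)) / 2.
  have d0 : 0 < d by rewrite /d /F; lra.
  have : \forall t \near b, F t < F b + d.
    by apply: cvgr_lt _ (@continuous_cdf _ _ hn alpha b) _ _; rewrite ltrDl.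
  move=> /nbhs_ballP[e1 /= e10 he1].
  have : \forall t \near a, F a - d < F t.
    by apply: cvgr_gt _ (@continuous_cdf _ _ hn alpha a) _ _; rewrite gtrBl.
  move=> /nbhs_ballP[e2 /= e20 he2].
  exists (Num.min e1 e2 / 2); first by rewrite divr_gt0// lt_min e10.
  move=> t /andP[t0 te].
  have [te1 te2] : t < e1 /\ t < e2.
    by move: te; rewrite ler_pdivlMr// le_min => /andP[]; lra.
  have hb : F (b + t) < F b + d.
    by apply: he1; rewrite /ball/= opprD addNKr normrN ger0_norm.
  have ha : F a - d < F (a - t).
    by apply: he2; rewrite /ball/= subKr ger0_norm.
  by move: ha hb; rewrite /d; lra.
exists e => // r /andP[r0 re]; rewrite -[leLHS]mul1r.
apply: (g_alpha_growth hn) => //; first exact: ltW.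
move=> t /andP[t0 tr]; rewrite mul1r.
apply: (alpha_pdf_endpoints_half_ge hn) => //.
  by lra.
by apply: he; lra.
Qed.
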